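(* Let $V$ be a finite-dimensional vector space over a field $F$ and let $S$ be a set of $m$ (distinct, ordered) bases of $V$. Let $G$ be the set of all change of basis matrices $M_{ts}$ with $s,t\in S$, regarded as typed matrices (so that each carries its pair of types $(t,s)$). Equip $G$ with the partial binary operation given by matrix multiplication, where the product of $M$ and $N$ is defined if and only if $M$ has the form $M_{ut}$ and $N$ has the form $M_{ts}$ for some $s,t,u\in S$, the product being an element of type $(u,s)$. Then $G$ is a connected groupoid of order $m^2$, i.e. $G$ has exactly $m^2$ elements.
   Context: All bases are ordered: for a basis $t=\{t_0,\dots,t_n\}$ of $V$, the coordinate vector of $v=\sum_{k=0}^n a_k t_k$ with respect to $t$ is $(a_0,\dots,a_n)$. For bases $s$ and $t$ of $V$, the change of basis matrix $M_{ts}$ is the square matrix whose columns are the (transposed) coordinate vectors, with respect to $t$, of the basis vectors of $s$, in order; thus if $b$ is the column of coordinates of a vector with respect to $s$, then $M_{ts}b$ is the column of coordinates of the same vector with respect to $t$. Change of basis matrices are typed: $M_{ts}$ and $M_{vu}$ are equal if and only if they have the same entries and $t=v$ and $s=u$. In particular the identity matrices $M_{tt}$ for different $t\in S$ are distinct elements. Groupoid is meant in the algebraic (Brandt) sense: a set $G$ with a partially defined binary operation that is associative (where the relevant products are defined), such that every element $M\in G$ has an inverse $M^{-1}\in G$, with $MM^{-1}$ and $M^{-1}M$ defined and acting as identity elements wherever products with them are defined. Equivalently, here, $G$ is the set of morphisms of a small category with object set $S$ in which every morphism is invertible, $M_{ts}$ being a morphism from $s$ to $t$. The groupoid is connected (transitive)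 if for any two objects $s,t\in S$ there is an element of $G$ from $s$ to $t$. The order of $G$ is its number of elements. *)

(* Defs.v *)
From HB Require Import structures.
From mathcomp Require Import all_boot all_order all_algebra.
From mathcomp Require Import finmap.

Set Implicit Arguments.
Unset Strict Implicit.
Unset Printing Implicit Defensive.

Import GRing.Theory.
Local Open Scope ring_scope.
Local Open Scope fset_scope.

(* A groupoid in the algebraic (Brandt) sense, carried by the subset G of T;  *)
(* [mul x y = None] means that the product of x and y is undefined.           *)
Section Groupoid.
Variables (T : Type) (G : {pred T}) (mul : T -> T -> option T).

Definition acts_as_identity (e : T) : Prop :=
  forall x y, x \in G ->
    (mul e x = Some y -> y = x) /\ (mul x e = Some y -> y = x).

Record groupoid : Prop := Groupoid {
  groupoid_closed : forall x y z,
    x \in G -> y \in G -> mul x y = Some z -> z \in G;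
  (* x(yz) is defined iff (xy)z is, and then they are equal *)
  groupoid_assoc : forall x y z, x \in G -> y \in G -> z \in G ->
    obind (mul x) (mul y z) = obind (mul^~ z) (mul x y);
  groupoid_assoc_def : forall x y z, x \in G -> y \in G -> z \in G ->
    isSome (mul x y) -> isSome (mul y z) ->
    isSome (obind (mul^~ z) (mul x y));
  groupoid_inv : forall x, x \in G ->
    exists y e f, [/\ y \in G, mul x y = Some e, mul y x = Some f,
                      acts_as_identity e & acts_as_identity f]
}.

Definition connected_over (Ob : Type) (S : {pred Ob}) (src tgt : T -> Ob) :
    Prop :=
  forall s t, s \in S -> t \in S ->
    exists M, [/\ M \in G, src M = s & tgt M = t].

End Groupoid.

Section ChangeOfBasis.
Variables (F : fieldType) (V : vectType F).

Definition ordered_basis : choiceType :=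
  {t : (\dim {:V}).-tuple V | basis_of {:V} t}.

(* [change_mx t s] is M_{ts}: column j holds the coordinates of s_j in t.     *)
Definition change_mx (t s : ordered_basis) : 'M[F]_(\dim {:V}) :=
  \matrix_(i, j) coord (val t) i (tnth (val s) j).

(* A matrix of type (t, s) is a triple (t, s, A), so that equality of typed   *)
(* matrices compares the types as well as the entries; it goes from s to t.   *)
Definition typed_mx : choiceType :=
  (ordered_basis * ordered_basis * 'M[F]_(\dim {:V}))%type.

Definition mx_tgt (M : typed_mx) : ordered_basis := M.1.1.
Definition mx_src (M : typed_mx) : ordered_basis := M.1.2.
Definition mx_val (M : typed_mx) : 'M[F]_(\dim {:V}) := M.2.

Definition typed_change_mx (t s : ordered_basis) : typed_mx :=
  (t, s, change_mx t s).

(* Defined exactly when the types are (u, t) and (t, s), with a result of     *)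
(* type (u, s).                                                               *)
Definition typed_mul (M N : typed_mx) : option typed_mx :=
  if mx_src M == mx_tgt N
  then Some (mx_tgt M, mx_src N, mx_val M *m mx_val N) else None.

Definition change_mxs (S : {fset ordered_basis}) : {fset typed_mx} :=
  [fset typed_change_mx t s | t in S, s in S].

End ChangeOfBasis.

(* Main.v *)
Require Import Defs.
From HB Require Import structures.
From mathcomp Require Import all_boot all_order all_algebra.
From mathcomp Require Import finmap.

Set Implicit Arguments.
Unset Strict Implicit.
Unset Printing Implicit Defensive.

Import GRing.Theory.
Local Open Scope ring_scope.
Local Open Scope fset_scope.

(** Everything rests on the identities [change_mxM] (M_ut M_ts = M_us) and [change_mx_id] (M_tt =
    1). They make G the pair groupoid on S: there is one arrow for each pair (t, s), composition
    forgets the middle basis, and M_st is inverse to M_ts. Connectedness is immediate because every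
    pair has its matrix. Since the types are part of an element, distinct pairs give distinct
    elements, so the order is m^2. *)

Section ChangeOfBasisTheory.
Variables (F : fieldType) (V : vectType F).
Implicit Types (s t u : ordered_basis V) (S : {fset ordered_basis V}).

(** Expand s_j in the basis t and apply the i-th coordinate form of u, which is linear: the
    resulting sum is the (i, j) entry of the product. *)
Lemma change_mxM u t s : change_mx u t *m change_mx t s = change_mx u s.
Proof.
apply/matrixP => i j; rewrite !mxE.
rewrite [in RHS](coord_basis (valP t) (memvf (tnth (val s) j))) linear_sum /=.
by apply: eq_bigr => k _; rewrite !mxE linearZ /= mulrC -tnth_nth.
Qed.

Lemma change_mx_id t : change_mx t t = 1%:M.
Proof.
apply/matrixP => i j; rewrite !mxE (tnth_nth 0) coord_free 1?eq_sym //.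
exact: (basis_free (svalP t)).
Qed.

Lemma typed_mulE u t s :
  typed_mul (typed_change_mx u t) (typed_change_mx t s) =
  Some (typed_change_mx u s).
Proof. by rewrite /typed_mul eqxx /mx_val /= change_mxM. Qed.

(** Holds for arbitrary typed matrices: either bracketing is defined exactly when both adjacent
    pairs of types match, and then matrix multiplication is associative. *)
Lemma typed_mulA (L M N : typed_mx V) :
  obind (typed_mul L) (typed_mul M N) =
  obind ((@typed_mul F V)^~ N) (typed_mul L M).
Proof.
rewrite /typed_mul; case: (mx_src M =P mx_tgt N) => [MN|/eqP/negPf MN];
  case: (mx_src L =P mx_tgt M) => [LM|/eqP/negPf LM] //=.
- by rewrite /mx_src /mx_tgt /mx_val /= in LM MN *; rewrite LM MN !eqxx mulmxA.
- by rewrite /mx_tgt /= in LM *; rewrite LM.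
- by rewrite /mx_src /= in MN *; rewrite MN.
Qed.

Lemma change_mxsP S (M : typed_mx V) :
  reflect (exists t s, [/\ t \in S, s \in S & M = typed_change_mx t s])
          (M \in change_mxs S).
Proof.
apply: (iffP (imfset2P _ _ _ _ _)) => /= [[t tS [s sS ->]]|[t [s [tS sS ->]]]].
  by exists t, s.
by exists t => //; exists s.
Qed.

Lemma typed_change_mx_identity S t :
  acts_as_identity (mem (change_mxs S)) (@typed_mul F V) (typed_change_mx t t).
Proof.
move=> M N /change_mxsP[v [u [_ _ ->]]]; split.
  (* If the product is defined, the types force t = v, so the left factor is the identity matrix and
     the types of M are kept. *)
  rewrite /typed_mul /=; case: eqP => //= tv; rewrite /mx_tgt /mx_src /= in tv *.
  by rewrite tv /mx_val /= change_mx_id mul1mx => -[].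
rewrite /typed_mul /=; case: eqP => //= ut; rewrite /mx_tgt /mx_src /= in ut *.
by rewrite -ut /mx_val /= change_mx_id mulmx1 => -[].
Qed.

Lemma change_mxs_groupoid S :
  groupoid (mem (change_mxs S)) (@typed_mul F V).
Proof.
split=> [x y z|x y z _ _ _|x y z|x].
- move=> /change_mxsP[u [t [uS tS ->]]] /change_mxsP[v [s [vS sS ->]]].
  rewrite {1}/typed_mul; case: eqP => // tv; rewrite /mx_tgt /mx_src /= in tv *.
  rewrite tv /mx_val /= change_mxM => -[<-].
  by apply/change_mxsP; exists u, s.
- exact: typed_mulA.
- move=> _ _ _; rewrite /typed_mul; case: eqP => //= _.
  (* The product of x and y has the source of y, so it composes with z exactly when y does. *)
  by rewrite /mx_src /=; case: eqP.
- move=> /change_mxsP[t [s [tS sS ->]]].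
  exists (typed_change_mx s t), (typed_change_mx t t), (typed_change_mx s s).
  split; rewrite ?typed_mulE //; try exact: typed_change_mx_identity.
  by apply/change_mxsP; exists s, t.
Qed.

Lemma change_mxs_connected S :
  connected_over (mem (change_mxs S)) (mem S) (@mx_src F V) (@mx_tgt F V).
Proof.
move=> s t sS tS; exists (typed_change_mx t s); split=> //.
by apply/change_mxsP; exists t, s.
Qed.

Lemma card_change_mxs S : #|` change_mxs S| = (#|` S| ^ 2)%N.
Proof.
(* The pair (t, s) is read off the first components of the triple, which gives injectivity. *)
rewrite (perm_size (enum_imfset2 _ _)); last by move=> [? ?] [? ?] _ _ [-> ->].
by rewrite size_allpairs -mulnn.
Qed.

End ChangeOfBasisTheory.

Theorem theorem1 (F : fieldType) (V : vectType F) (m : nat)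
    (S : {fset ordered_basis V})
    (S_card : #|` S| = m) :
  [/\ groupoid (mem (change_mxs S)) (@typed_mul F V),
      connected_over (mem (change_mxs S)) (mem S) (@mx_src F V) (@mx_tgt F V)
    & #|` change_mxs S| = (m ^ 2)%N].
Proof.
rewrite -S_card; split; first exact: change_mxs_groupoid.
  exact: change_mxs_connected.
exact: card_change_mxs.
Qed.
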